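(* Let $\mathcal{X}$ be a Polish space with its Borel $\sigma$-algebra, and let $\overline{\mathcal{P}}(\mathcal{X})$ be the collection of all nonempty, weakly compact, convex sets of Borel probability measures on $\mathcal{X}$. For $\mathcal{P},\mathcal{Q}\in\overline{\mathcal{P}}(\mathcal{X})$: (i) $0\le\mathrm{JS}(\mathcal{P},\mathcal{Q})\le\log 2$; (ii) $\mathrm{JS}(\mathcal{P},\mathcal{Q})=0$ if and only if $\mathcal{P}=\mathcal{Q}$; (iii) $\mathrm{JS}(\cdot,\cdot)$ is a (jointly) convex function: for all $\mathcal{P}_1,\mathcal{P}_2,\mathcal{Q}_1,\mathcal{Q}_2\in\overline{\mathcal{P}}(\mathcal{X})$ and $\lambda_1,\lambda_2\in[0,1]$ with $\lambda_1+\lambda_2=1$, $$\mathrm{JS}(\lambda_1\mathcal{P}_1+\lambda_2\mathcal{P}_2,\ \lambda_1\mathcal{Q}_1+\lambda_2\mathcal{Q}_2)\le\lambda_1\mathrm{JS}(\mathcal{P}_1,\mathcal{Q}_1)+\lambda_2\mathrm{JS}(\mathcal{P}_2,\mathcal{Q}_2).$$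
   Context: ''Weakly compact'' means compact in the topology of weak convergence of probability measures; $\log$ is the natural logarithm. For probability measures $\mu,\nu$, $\mathrm{KL}(\mu\parallel\nu)=\int_{\mathcal{X}}\log\left(\frac{d\mu}{d\nu}\right)d\mu$ if $\mu\ll\nu$, and $+\infty$ otherwise. For sets of probability measures, $\mathrm{KL}(\mathcal{P}\parallel\mathcal{Q}):=\sup_{\mu\in\mathcal{P}}\inf_{\nu\in\mathcal{Q}}\mathrm{KL}(\mu\parallel\nu)$ and $\mathrm{JS}(\mathcal{P},\mathcal{Q}):=\frac12\mathrm{KL}(\mathcal{P}\parallel\mathcal{M})+\frac12\mathrm{KL}(\mathcal{Q}\parallel\mathcal{M})$ with $\mathcal{M}=\left\{\frac{\mu+\nu}{2}:\mu\in\mathcal{P},\nu\in\mathcal{Q}\right\}$. Convex combinations of sets are $\lambda_1\mathcal{P}_1+\lambda_2\mathcal{P}_2:=\{\lambda_1\mu_1+\lambda_2\mu_2:\mu_1\in\mathcal{P}_1,\mu_2\in\mathcal{P}_2\}$. *)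

(* Defs.v *)
From mathcomp Require Import all_boot all_order all_algebra.
From mathcomp Require Import all_classical all_reals all_analysis.

Set Implicit Arguments.
Unset Strict Implicit.
Unset Printing Implicit Defensive.

Import Order.TTheory GRing.Theory Num.Theory.
Import numFieldNormedType.Exports.

Local Open Scope classical_set_scope.
Local Open Scope ring_scope.

Definition separable_space (X : topologicalType) : Prop :=
  exists2 D : set X, countable D & dense D.

(* The metric is not part of the data of X: it is only required to exist, and
   to induce the given topology. *)
Definition completely_metrizable (R : realType) (X : topologicalType) : Prop :=
  exists d : X -> X -> R,
    [/\ (forall x y, d x y = 0 <-> x = y),
        (forall x y, d x y = d y x),
        (forall x y z, d x z <= d x y + d y z),
        (forall x (A : set X), nbhs x A <->
           exists2 e : R, 0 < e & [set y | d x y < e] `<=` A) &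
        (forall u : nat -> X,
           (forall e : R, 0 < e -> exists N : nat, forall m n : nat,
              (N <= m)%N -> (N <= n)%N -> d (u m) (u n) < e) ->
           exists l : X, u @ \oo --> l)].

Definition polish (R : realType) (X : topologicalType) : Prop :=
  separable_space X /\ completely_metrizable R X.

Definition borel (X : ptopologicalType) := g_sigma_algebraType (@open X).

Notation borel_probability X R := (probability (borel X) R).

Definition bounded_continuous (R : realType) (X : topologicalType) : Type :=
  {f : X -> R | continuous f /\ bounded_fun f}.

Definition integrals (R : realType) (X : ptopologicalType)
    (mu : borel_probability X R) : {ptws (bounded_continuous R X) -> R} :=
  fun f => (\int[mu]_x (sval f x))%R.

(* The topology of weak convergence: the coarsest one making
   mu |-> \int f dmu continuous for every bounded continuous f. *)
Definition weak_probability (R : realType) (X : ptopologicalType) :=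
  initial_topology (@integrals R X).

Definition weakly_compact (R : realType) (X : ptopologicalType)
    (P : set (borel_probability X R)) : Prop :=
  compact (P : set (weak_probability R X)).

(* Only the values on Borel sets matter: a [probability] is a function on all
   subsets, whose values outside the sigma-algebra are unconstrained. *)
Definition combination (R : realType) (X : ptopologicalType) (a b : R)
    (P Q : set (borel_probability X R)) : set (borel_probability X R) :=
  [set m | exists2 mu, P mu & exists2 nu, Q nu &
     forall A : set (borel X), measurable A ->
       m A = (a%:E * mu A + b%:E * nu A)%E].

(* With a = 1 this implies that P is closed under equality on Borel sets, so that
   convex sets here correspond exactly to convex sets of Borel measures and
   P = Q is equality of the latter. *)
Definition convex_probabilities (R : realType) (X : ptopologicalType)
    (P : set (borel_probability X R)) : Prop :=
  forall a b : R, 0 <= a <= 1 -> 0 <= b <= 1 -> a + b = 1 ->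
    combination a b P P `<=` P.

Definition Pbar (R : realType) (X : ptopologicalType) :
    set (set (borel_probability X R)) :=
  [set P | [/\ P !=set0, weakly_compact P & convex_probabilities P]].

Local Open Scope ereal_scope.
Local Open Scope charge_scope.

Definition KL (d : measure_display) (T : measurableType d) (R : realType)
    (mu nu : probability T R) : \bar R :=
  if `[< mu `<< nu >] then
    \int[mu]_x lne (('d (charge_of_finite_measure mu) '/d nu) x)
  else +oo.

Definition KL_set (d : measure_display) (T : measurableType d) (R : realType)
    (P Q : set (probability T R)) : \bar R :=
  ereal_sup [set ereal_inf [set KL mu nu | nu in Q] | mu in P].

Definition JS (R : realType) (X : ptopologicalType)
    (P Q : set (borel_probability X R)) : \bar R :=
  let M := combination 2^-1 2^-1 P Q in
  2^-1%:E * KL_set P M + 2^-1%:E * KL_set Q M.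

(* Main.v *)
Require Import Defs.
From HB Require Import structures.
From mathcomp Require Import all_boot all_order all_algebra.
From mathcomp Require Import all_classical all_reals all_analysis.
From mathcomp Require Import measurable_realfun lra ring.

Set Implicit Arguments.
Unset Strict Implicit.
Unset Printing Implicit Defensive.

Import Order.TTheory GRing.Theory Num.Theory.
Import numFieldNormedType.Exports.

Local Open Scope classical_set_scope.
Local Open Scope ereal_scope.

(** The proof rests on a variational formula for the relative entropy,

      KL(mu || nu) = sup_h (\int h dmu + 1 - \int e^h dnu),

    the supremum being over bounded measurable h ([entropy_dual_le_KL] and
    [KL_le_entropy_dual]). Everything else about KL is read off from it, with no
    further use of densities, because the expression under the supremum is
    jointly affine in (mu, nu):

    - KL is nonnegative (take h = 0) and jointly convex (a supremum of affine
      functions), see [KL_mixture_convex];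
    - KL(mu || (mu + nu)/2) <= ln 2, because u + 1 - e^u / 2 <= ln 2 for every
      real u, see [KL_mixture_le_ln];
    - if KL(mu || nu) is small, then the integrals of every f with |f| <= 1
      against mu and nu are close, uniformly in f: take h = t f with t small
      ([KL_small_Rintegral], which plays the role of Pinsker's inequality).

    The bounds on JS follow from the first two facts. Joint convexity of JS
    follows from that of KL, once one observes that mixing the two sets of
    midpoints gives midpoints of the mixed sets ([combination_interchange]).

    For JS(P, Q) = 0 -> P = Q, write M for the set of midpoints, and measure
    the distance of two probabilities by the largest difference of the integrals
    of a bounded continuous f with |f| <= 1. Both divergences to M vanish, so
    every mu in P is approximated by midpoints (p + q)/2. Thus, if every element
    of P is at distance at most r from Q, then every element of P is at distance
    at most r/2 + epsilon from Q: take (q' + q)/2, with q' in Q approximating p.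
    Hence all elements of P are at distance 0 from Q ([close_by_halving]). This
    is a cancellation law: if P lies in the closure of (P + Q)/2 with Q convex,
    then P lies in the closure of Q. Weak compactness of Q then provides an
    element of Q with the same integrals of bounded continuous functions as mu
    ([weakly_compact_closed]), and in a metrizable space it agrees with mu on
    Borel sets ([eq_probability_bounded_continuous]). *)

(** * Integrals of bounded measurable functions and mixtures *)

Section mixture.
Context d (T : measurableType d) (R : realType).
Variables (a b : R) (a0 : (0 <= a)%R) (b0 : (0 <= b)%R) (ab1 : (a + b = 1)%R).
Variables mu nu : probability T R.

(** The equation [a + b = 1] is an argument so that a probability structure can
    be inferred from the term alone. *)
Definition mixture of (a + b = 1)%R : set T -> \bar R :=
  measure_add (mscale (NngNum a0) mu) (mscale (NngNum b0) nu).

Lemma mixtureE A : mixture ab1 A = a%:E * mu A + b%:E * nu A.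
Proof. exact: measure_addE. Qed.

HB.instance Definition _ := Measure.on (mixture ab1).

Let mixture_setT : mixture ab1 setT = 1.
Proof. by rewrite mixtureE !probability_setT !mule1 -EFinD ab1. Qed.

HB.instance Definition _ := Measure_isProbability.Build _ _ _ (mixture ab1)
  mixture_setT.

End mixture.

Lemma mixture_exists d (T : measurableType d) (R : realType) (a b : R)
    (mu nu : probability T R) : (0 <= a)%R -> (0 <= b)%R -> (a + b = 1)%R ->
  exists m : probability T R, forall A, m A = a%:E * mu A + b%:E * nu A.
Proof.
move=> a0 b0 ab1.
by exists (mixture a0 b0 mu nu ab1) => A; exact: mixtureE.
Qed.

Definition bounded_measurable d (T : measurableType d) (R : realType)
    (h : T -> R) : Prop :=
  measurable_fun setT h /\ exists M : R, forall x, (`|h x| <= M)%R.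

Section bounded_measurable_functions.
Context d (T : measurableType d) (R : realType).
Implicit Types (mu nu m : probability T R) (f g h : T -> R).

Lemma bounded_measurable_integrable mu h :
  bounded_measurable h -> mu.-integrable setT (EFin \o h).
Proof.
move=> [mh [M hM]]; apply: measurable_bounded_integrable => //.
  by rewrite (le_lt_trans (probability_le1 mu measurableT)) ?ltry.
exists M; split; first by rewrite num_real.
by move=> x Mx y _ /=; rewrite (le_trans (hM y))// ltW.
Qed.

Lemma bounded_measurable_cst (c : R) : bounded_measurable (cst c : T -> R).
Proof. by split => //; exists `|c|%R. Qed.

Lemma bounded_measurable_add f g : bounded_measurable f ->
  bounded_measurable g -> bounded_measurable (fun x => f x + g x)%R.
Proof.
move=> [mf [M fM]] [mg [N gN]]; split; first exact: measurable_funD.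
by exists (M + N)%R => x; rewrite (le_trans (ler_normD _ _))// lerD.
Qed.

Lemma bounded_measurable_scale (c : R) f : bounded_measurable f ->
  bounded_measurable (fun x => c * f x)%R.
Proof.
move=> [mf [M fM]]; split; first exact: measurable_funM.
by exists (`|c| * M)%R => x; rewrite normrM ler_wpM2l.
Qed.

Lemma bounded_measurable_expR f : bounded_measurable f ->
  bounded_measurable (fun x => expR (f x)).
Proof.
move=> [mf [M fM]]; split; first exact: measurableT_comp.
exists (expR M) => x; rewrite ger0_norm ?expR_ge0// ler_expR.
by rewrite (le_trans (ler_norm _)).
Qed.

Lemma Rintegral_cst_probability mu (c : R) : (\int[mu]_x c)%R = c.
Proof.
by rewrite Rintegral_cst// [X in fine X](probability_setT mu) mulr1.
Qed.

Lemma Rintegral_add mu f g : bounded_measurable f -> bounded_measurable g ->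
  (\int[mu]_x (f x + g x) = \int[mu]_x f x + \int[mu]_x g x)%R.
Proof.
by move=> bf bg; rewrite RintegralD//; exact: bounded_measurable_integrable.
Qed.

Lemma Rintegral_scale mu (c : R) f : bounded_measurable f ->
  (\int[mu]_x (c * f x) = c * \int[mu]_x f x)%R.
Proof.
by move=> bf; rewrite RintegralZl//; exact: bounded_measurable_integrable.
Qed.

Lemma Rintegral_le mu f g : bounded_measurable f -> bounded_measurable g ->
  (forall x, f x <= g x)%R -> (\int[mu]_x f x <= \int[mu]_x g x)%R.
Proof.
move=> bf bg fg.
by apply: le_Rintegral => //; exact: bounded_measurable_integrable.
Qed.

Lemma EFin_Rintegral mu f : bounded_measurable f ->
  ((\int[mu]_x f x)%R)%:E = \int[mu]_x (f x)%:E.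
Proof.
move=> bf; rewrite /Rintegral fineK//.
by apply: integrable_fin_num => //; exact: bounded_measurable_integrable.
Qed.

(** The integral is additive in the measure for nonnegative functions; a bounded
    function is reduced to that case by adding a constant. *)
Lemma Rintegral_mixture (a b : R) m mu nu f :
  (0 <= a)%R -> (0 <= b)%R ->
  (forall A, measurable A -> m A = a%:E * mu A + b%:E * nu A) ->
  bounded_measurable f ->
  (\int[m]_x f x = a * \int[mu]_x f x + b * \int[nu]_x f x)%R.
Proof.
move=> a0 b0 mE bf.
have ab1 : (a + b = 1)%R.
  have := mE setT measurableT.
  rewrite probability_setT probability_setT.
  by rewrite probability_setT !mule1 -EFinD => -[].
have [M fM] := bf.2.
have bfM : bounded_measurable (fun x => f x + M)%R.
  by apply: bounded_measurable_add => //; exact: bounded_measurable_cst.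
have fM0 x : (0 <= f x + M)%R.
  by have := fM x; rewrite ler_norml => /andP[+ _]; lra.
have shift (k : probability T R) : (\int[k]_x (f x + M) = \int[k]_x f x + M)%R.
  rewrite Rintegral_add ?Rintegral_cst_probability//.
  exact: bounded_measurable_cst.
suff : (\int[m]_x (f x + M) =
        a * \int[mu]_x (f x + M) + b * \int[nu]_x (f x + M))%R.
  by rewrite !shift; nra.
apply: EFin_inj; rewrite EFinD !EFinM !EFin_Rintegral//.
pose m0 := measure_add (mscale (NngNum a0) mu) (mscale (NngNum b0) nu).
have mf : measurable_fun setT (fun x => (f x + M)%:E).
  by apply/measurable_EFinP; case: bfM.
rewrite (eq_measure_integral m0); last first.
  by move=> A mA _; apply: etrans (mE A mA) _; apply/esym; exact: measure_addE.
rewrite ge0_integral_measure_add//; last by move=> x _; rewrite lee_fin.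
by rewrite !ge0_integral_mscale//; move=> x _; rewrite lee_fin.
Qed.

End bounded_measurable_functions.

(** Monotone convergence, with the pointwise limit given in advance. *)
Lemma cvg_nondecreasing_integral d (T : measurableType d) (R : realType)
    (mu : probability T R) (a : nat -> T -> R) (f : T -> R) :
  (forall n, measurable_fun setT (a n)) -> (forall n x, 0 <= a n x)%R ->
  (forall x m n, (m <= n)%N -> (a m x <= a n x)%R) ->
  (forall x, a n x @[n --> \oo] --> f x) ->
  \int[mu]_x (a n x)%:E @[n --> \oo] --> \int[mu]_x (f x)%:E.
Proof.
move=> ma a0 nda af.
have fE x : (f x)%:E = limn (fun n => (a n x)%:E).
  by apply/esym/cvg_lim => //; apply: cvg_EFin; [exact: nearW|exact: af].
under [X in _ --> X]eq_integral do rewrite fE.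
apply: cvg_monotone_convergence => //.
- by move=> n; apply/measurable_EFinP.
- by move=> n x _; rewrite lee_fin.
- by move=> x _ m n mn; rewrite lee_fin nda.
Qed.

(** * The variational formula for the relative entropy *)

Section relative_entropy.
Context d (T : measurableType d) (R : realType).
Implicit Types (mu nu m : probability T R) (f g h : T -> R).

Lemma measurable_lne (f : T -> R) : measurable_fun setT f ->
  measurable_fun setT (fun x => lne (f x)%:E).
Proof.
move=> mf; apply: (measurable_fun_ifT (f := fun x => (f x <= 0)%R)) => //.
- exact: measurable_fun_ler.
- by apply/measurable_EFinP; exact: measurableT_comp.
Qed.

Local Open Scope charge_scope.

(** A real-valued nonnegative density. Almost everywhere for mu (though possibly
    not for nu) it is positive, so that the extended logarithm can be replaced by
    [ln], with the harmless value [ln 0 = 0] on the exceptional set. *)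
Lemma KL_density mu nu : mu `<< nu -> exists g : T -> R,
  [/\ measurable_fun setT g, (forall x, 0 <= g x)%R,
      {ae mu, forall x, (0 < g x)%R},
      KL mu nu = \int[mu]_x (ln (g x))%:E &
      forall F : T -> \bar R, measurable_fun setT F -> (forall x, 0 <= F x) ->
        \int[nu]_x (F x * (g x)%:E) = \int[mu]_x F x].
Proof.
move=> munu; pose D := Radon_Nikodym_SigmaFinite.f mu nu.
have Dfin x : D x \is a fin_num by exact: Radon_Nikodym_SigmaFinite.f_fin_num.
have gD x : (fine (D x))%:E = D x by rewrite fineK.
have mD : measurable_fun setT D.
  exact: measurable_int (Radon_Nikodym_SigmaFinite.f_integrable munu).
have mg : measurable_fun setT (fine \o D).
  by apply/measurable_EFinP; apply: eq_measurable_fun mD => x _ /=; rewrite gD.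
have g0 x : (0 <= fine (D x))%R.
  by rewrite fine_ge0// Radon_Nikodym_SigmaFinite.f_ge0.
have cv (F : T -> \bar R) : measurable_fun setT F -> (forall x, 0 <= F x) ->
    \int[nu]_x (F x * (fine (D x))%:E) = \int[mu]_x F x.
  move=> mF F0; under eq_integral do rewrite gD.
  exact: Radon_Nikodym_SigmaFinite.change_of_variables.
have g_gt0 : {ae mu, forall x, (0 < fine (D x))%R}.
  have mZ : measurable [set x | fine (D x) <= 0]%R.
    have : measurable_fun setT (fun x => fine (D x) <= 0)%R.
      exact: measurable_fun_ler.
    by move=> /(_ measurableT [set true] I); rewrite setTI.
  exists [set x | fine (D x) <= 0]%R; split => //; last first.
    by move=> x /= /negP; rewrite -leNgt.
  have mI : measurable_fun setT
      (fun x => (\1_[set x | fine (D x) <= 0]%R x)%:E : \bar R).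
    by apply/measurable_EFinP; exact: measurable_indic.
  rewrite -[X in mu X]setIT -integral_indic// -cv//.
  rewrite integral0_eq// => x _; rewrite indicE.
  have [/[!inE]/= gx0|] := boolP (x \in _); last by rewrite mul0e.
  by rewrite (_ : fine (D x) = 0%R) ?mule0//; apply/eqP; rewrite eq_le gx0 g0.
exists (fine \o D); split => //.
rewrite /KL; case: asboolP => // _.
  have munu' : charge_of_finite_measure mu `<< nu by exact: munu.
  pose r := 'd (charge_of_finite_measure mu) '/d nu.
  have rE x : (fine (r x))%:E = r x by rewrite fineK// Radon_Nikodym_fin_num.
  have mr : measurable_fun setT (fine \o r).
    apply/measurable_EFinP; apply: (eq_measurable_fun r); last first.
      by apply: measurable_int; exact: Radon_Nikodym_integrable.
    by move=> x _; rewrite -[LHS]rE.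
  apply: ae_eq_integral => //.
  + apply: (eq_measurable_fun (fun x => lne (fine (r x))%:E)).
      by move=> x _; rewrite rE.
    exact: measurable_lne.
  + by apply/measurable_EFinP; exact: measurableT_comp.
  + have : ae_eq mu setT D r.
      apply: null_dominates_ae_eq munu _ => //.
      exact: ae_eq_Radon_Nikodym_SigmaFinite.
    apply: filterS2 g_gt0 => x gx0 /(_ I) Dr _.
    by rewrite -[LHS]/(lne (r x)) -Dr -[in LHS]gD lne_EFin.
Qed.

Definition entropy_dual mu nu h : R :=
  (\int[mu]_x h x + 1 - \int[nu]_x expR (h x))%R.

(** Convexity of exp gives 1 + h <= ln g + e^h / g wherever the density g is
    positive. Integrate against mu: the last term contributes at most
    \int e^h dnu. The case h = 0 shows that the negative part of ln g is
    integrable, so that the integral defining KL is not of the form oo - oo. *)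
Lemma entropy_dual_le_KL mu nu h : bounded_measurable h ->
  (entropy_dual mu nu h)%:E <= KL mu nu.
Proof.
move=> bh.
have [/[dup] munu|nmunu] := pselect (mu `<< nu); last first.
  by rewrite /KL; case: asboolP => // _; rewrite leey.
move=> /KL_density[g [mg g0 _ -> cv]].
(* Where g vanishes it is replaced by 1: this leaves ln g unchanged, since
   ln 0 = 0 = ln 1, and makes the pointwise inequality hold everywhere. *)
pose gt x := if (0 < g x)%R then g x else 1%R.
have gt_gt0 x : (0 < gt x)%R by rewrite /gt; case: ifPn.
have ln_gt x : ln (gt x) = ln (g x).
  by rewrite /gt; case: ifPn => //; rewrite -leNgt => gx0; rewrite ln1 ln0.
have mgt : measurable_fun setT gt.
  apply: measurable_fun_ifT => //; exact: measurable_fun_ltr.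
have mV : measurable_fun setT (fun x => (gt x)^-1%R).
  apply: (eq_measurable_fun (fun x => expR (- ln (g x)))%R).
    by move=> x _; rewrite expRN -ln_gt lnK ?posrE.
  apply: measurableT_comp => //; apply: measurable_funN.
  exact: measurableT_comp.
pose k (u : T -> R) x := (expR (u x) / gt x)%R.
have k0 u x : (0 <= k u x)%R by rewrite divr_ge0 ?expR_ge0// ltW.
have mk u : bounded_measurable u -> measurable_fun setT (k u).
  move=> [mu_ _]; apply: measurable_funM => //; exact: measurableT_comp.
(* Changing variables multiplies by g, and g / gt is 0 or 1. *)
have kle u : bounded_measurable u ->
    \int[mu]_x (k u x)%:E <= ((\int[nu]_x expR (u x))%R)%:E.
  move=> bu; rewrite EFin_Rintegral; last exact: bounded_measurable_expR.
  have mkE : measurable_fun setT (EFin \o k u).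
    by apply/measurable_EFinP; exact: mk.
  have kE0 x : 0 <= (EFin \o k u) x by rewrite lee_fin.
  rewrite -(cv _ mkE kE0).
  apply: ge0_le_integral => //.
  - by move=> x _; rewrite /= -EFinM lee_fin mulr_ge0.
  - by apply/measurable_EFinP/measurable_funM => //; exact: mk.
  - by apply/measurable_EFinP; case: (bounded_measurable_expR bu).
  - move=> x _; rewrite /= -EFinM lee_fin /k -mulrA ler_piMr ?expR_ge0//.
    rewrite /gt; case: ifPn => [gx0|]; first by rewrite mulVf// gt_eqF.
    by rewrite -leNgt invr1 mul1r => /le_trans; apply.
have key u x : (1 + u x <= ln (g x) + k u x)%R.
  have -> : k u x = expR (u x - ln (g x)) by rewrite expRB -ln_gt lnK ?posrE.
  by have := expR_ge1Dx (u x - ln (g x)); lra.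
pose l x := (ln (g x))%:E.
have ml : measurable_fun setT l.
  by apply/measurable_EFinP; exact: measurableT_comp.
have lneg : \int[mu]_x l^\- x < +oo.
  have kle0 := kle (cst 0%R) (@bounded_measurable_cst _ _ R 0%R).
  apply: le_lt_trans (le_lt_trans kle0 (ltry _)).
  apply: ge0_le_integral => //.
  - exact: measurable_funeneg.
  - by apply/measurable_EFinP; apply: mk; exact: bounded_measurable_cst.
  move=> x _; rewrite funenegE -EFinN -EFin_max lee_fin ge_max k0 andbT.
  by have := key (cst 0%R) x; rewrite /=; lra.
have lnegfin : \int[mu]_x l^\- x \is a fin_num.
  by rewrite ge0_fin_numE// integral_ge0.
have [lpos|lpos] := eqVneq (\int[mu]_x l^\+ x) +oo.
  rewrite [leRHS]integralE lpos addye ?leey//.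
  by move: lnegfin; rewrite -fin_numN fin_numE => /andP[].
have il : mu.-integrable setT l.
  apply/integrableP; split => //.
  under eq_integral do rewrite -[`|l _|]/((abse \o l) _) fune_abse.
  rewrite ge0_integralD//; [|exact: measurable_funepos|exact: measurable_funeneg].
  by rewrite lte_add_pinfty// ltey.
have ik : mu.-integrable setT (EFin \o k h).
  apply/integrableP; split; first by apply/measurable_EFinP; exact: mk.
  under eq_integral do rewrite /= ger0_norm//.
  by rewrite (le_lt_trans (kle _ bh))// ltry.
have b1 : bounded_measurable (fun x => 1 + h x)%R.
  by apply: bounded_measurable_add => //; exact: bounded_measurable_cst.
rewrite /entropy_dual [X in X%:E](_ : _ =
  \int[mu]_x (1 + h x) - \int[nu]_x expR (h x))%R; last first.
  rewrite Rintegral_add// ?Rintegral_cst_probability.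
    by rewrite [(1 + _)%R]addrC.
  exact: bounded_measurable_cst.
rewrite EFinB leeBlDr// EFin_Rintegral//.
apply: (@le_trans _ _ (\int[mu]_x (l x + (k h x)%:E))).
  apply: le_integral => //.
  - exact: bounded_measurable_integrable.
  - exact: integrableD.
  - by move=> x _; rewrite -EFinD lee_fin.
by rewrite integralD// leeD2l// kle.
Qed.

Lemma entropy_dual0 mu nu : entropy_dual mu nu (cst 0%R) = 0%R.
Proof.
rewrite /entropy_dual (Rintegral_cst_probability mu 0%R).
under eq_Rintegral do rewrite /= expR0.
by rewrite Rintegral_cst_probability add0r subrr.
Qed.

Lemma bounded_measurable_indic (A : set T) : measurable A ->
  bounded_measurable (\1_A : T -> R)%R.
Proof.
move=> mA; split; first exact: measurable_indic.
by exists 1%R => x; rewrite indicE ger0_norm// lern1 leq_b1.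
Qed.

(** Scaled indicators of nu-null sets detect the failure of absolute continuity:
    as n grows, the value tends to +oo unless mu charges A with mass 0. *)
Lemma entropy_dual_null mu nu (A : set T) (n : R) : measurable A -> nu A = 0 ->
  entropy_dual mu nu (fun x => n * \1_A x)%R = (n * fine (mu A))%R.
Proof.
move=> mA nuA0; have bA := bounded_measurable_indic mA.
have intA (k : probability T R) : (\int[k]_x \1_A x)%R = fine (k A).
  by rewrite /Rintegral integral_indic// setIT.
rewrite /entropy_dual Rintegral_scale// intA.
under [X in (_ - X)%R]eq_Rintegral => x _.
  rewrite (_ : expR _ = 1 + (expR n - 1) * \1_A x)%R; last first.
    by rewrite indicE; case: (_ \in _); rewrite ?mulr1 ?mulr0 ?expR0; lra.
  over.
rewrite Rintegral_add ?Rintegral_scale//; last 2 first.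
- exact: bounded_measurable_cst.
- exact: bounded_measurable_scale.
by rewrite intA nuA0 Rintegral_cst_probability/=; lra.
Qed.

(** The optimal choice h = ln g, with g the density of mu, need not be bounded.
    Truncate g from below at e1 and from above at e^n. The lower truncation makes
    \int e^h dnu exceed 1 by at most e1, and the upper one is removed by
    monotone convergence applied to the positive parts. *)
Lemma KL_le_entropy_dual mu nu (S : \bar R) :
  (forall h, bounded_measurable h -> (entropy_dual mu nu h)%:E <= S) ->
  KL mu nu <= S.
Proof.
move=> hS.
have S0 : 0 <= S.
  rewrite -[0](congr1 EFin (entropy_dual0 mu nu)); apply: hS.
  exact: bounded_measurable_cst.
case: S hS S0 => [s| |] hS S0; [|by rewrite leey|by []].
rewrite lee_fin in S0.
have [/[dup] munu|nmunu] := pselect (mu `<< nu); last first.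
  exfalso; apply: nmunu; apply/null_content_dominatesP => A mA nuA.
  have muA : mu A \is a fin_num by rewrite fin_num_measure.
  apply/eqP; rewrite eq_le measure_ge0 andbT leNgt; apply/negP => muA0.
  have a0 : (0 < fine (mu A))%R by rewrite -lte_fin fineK.
  (* This multiple of the indicator of A has the dual value s + 1 > s. *)
  have := hS _ (bounded_measurable_scale ((s + 1) / fine (mu A))
    (bounded_measurable_indic mA)).
  rewrite entropy_dual_null// lee_fin divfK ?gt_eqF//; lra.
move=> /KL_density[g [mg g0 g_gt0 KLE cv]].
pose l x := (ln (g x))%:E.
have ml : measurable_fun setT l.
  by apply/measurable_EFinP; exact: measurableT_comp.
have [lneg|lneg] := eqVneq (\int[mu]_x l^\- x) +oo.
  by rewrite KLE integralE lneg/= addeNy leNye.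
have lnegfin : \int[mu]_x l^\- x \is a fin_num.
  by rewrite ge0_fin_numE ?integral_ge0// lt_neqAle lneg leey.
rewrite KLE integralE leeBlDr//.
apply/lee_addgt0Pr => e e0.
have [e1 [e10 e1e e11]] : exists e1 : R, [/\ 0 < e1, e1 <= e & e1 <= 1]%R.
  by exists (Num.min e 1%R); split; rewrite ?lt_min ?ge_min ?e0 ?ltr01 ?lexx ?orbT.
pose p (n : nat) x : R := Num.max e1 (Num.min (g x) (expR n%:R)).
have p0 n x : (0 < p n x)%R by rewrite lt_max e10.
have mp n : measurable_fun setT (p n).
  by apply: measurable_maxr => //; exact: measurable_minr.
pose h n x := ln (p n x).
have bh n : bounded_measurable (h n).
  split; first exact: measurableT_comp.
  exists (n%:R - ln e1)%R => x.
  have e1p : (ln e1 <= h n x)%R by rewrite ler_ln ?posrE// le_max lexx.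
  have pn : (h n x <= n%:R)%R.
    rewrite -[leRHS]expRK ler_ln ?posrE ?expR_gt0// /p ge_max ge_min.
    rewrite lexx orbT andbT.
    by rewrite (le_trans e11)// -expR0 ler_expR.
  have lne1 : (ln e1 <= 0)%R by rewrite -ln1 ler_ln ?posrE.
  have n0 : (0 <= n%:R :> R)%R := ler0n _ _.
  by rewrite ler_norml; apply/andP; split; lra.
(* The lower truncation only increases ln g. *)
have hge n x : (0 < g x)%R -> (Num.min (ln (g x)) n%:R <= h n x)%R.
  move=> gx0; rewrite -[X in Num.min _ X]expRK.
  have [gn|gn] := leP (g x) (expR n%:R)%R.
    by rewrite ge_min ler_ln ?posrE// le_max le_min lexx gn orbT.
  rewrite ge_min [X in _ || X]ler_ln ?posrE ?expR_gt0//.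
  by rewrite le_max le_min lexx (ltW gn) !orbT.
(* The positive part of ln g cut at n: it lies below the positive part of h n,
   and increases to the positive part of ln g. *)
pose a n x : R := (Num.min (Num.max (ln (g x)) 0) n%:R)%R.
have a0 n x : (0 <= a n x)%R by rewrite le_min le_max lexx orbT ler0n.
have ma n : measurable_fun setT (a n).
  apply: measurable_minr => //; apply: measurable_maxr => //.
  exact: measurableT_comp.
have ah n x : (a n x)%:E <= (EFin \o h n)^\+ x.
  rewrite funeposE -EFin_max lee_fin /a.
  have [gx0|gx0] := ltP 0%R (g x); last first.
    by rewrite ln0// maxxx ge_min le_max lexx orbT.
  have [_|_] := leP (ln (g x)) 0%R.
    by rewrite ge_min le_max lexx orbT.
  by rewrite le_max hge.
have mh n : measurable_fun setT (EFin \o h n).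
  by apply/measurable_EFinP; case: (bh n).
have hneg n : \int[mu]_x (EFin \o h n)^\- x <= \int[mu]_x l^\- x.
  apply: ae_ge0_le_integral => //.
  - exact: measurable_funeneg.
  - exact: measurable_funeneg.
  apply: filterS g_gt0 => x gx0 _.
  rewrite !funenegE /l /= -!EFin_max lee_fin.
  have := hge n x gx0; have n0 : (0 <= n%:R :> R)%R := ler0n _ _.
  rewrite ge_min ge_max !le_max lexx orbT andbT.
  by move=> /orP[lh|nh]; apply/orP; [left|right]; lra.
have exph n : (\int[nu]_x expR (h n x) <= 1 + e1)%R.
  rewrite -lee_fin EFin_Rintegral; last exact: bounded_measurable_expR.
  have intg : \int[nu]_x (g x)%:E = 1.
    under eq_integral do rewrite -[(g _)%:E]mul1e.
    by rewrite (cv (cst 1))// integral_cst// mul1e; exact: probability_setT.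
  apply: (@le_trans _ _ (\int[nu]_x ((g x)%:E + e1%:E))).
    apply: ge0_le_integral => //.
    - by apply/measurable_EFinP; case: (bounded_measurable_expR (bh n)).
    - by apply/measurable_EFinP; exact: measurable_funD.
    move=> x _; rewrite -EFinD lee_fin /h lnK ?posrE// ge_max lerDr g0 /=.
    by rewrite ge_min lerDl ltW.
  rewrite ge0_integralD//; last 3 first.
  - by move=> x _; rewrite lee_fin.
  - by apply/measurable_EFinP.
  - by move=> x _; rewrite lee_fin ltW.
  by rewrite intg integral_cst// [X in _ * X](probability_setT nu) mule1.
have aint n : \int[mu]_x (a n x)%:E <= s%:E + \int[mu]_x l^\- x + e%:E.
  have hn := hS _ (bh n).
  have hl : \int[mu]_x (h n x)%:E <= (s + e)%:E.
    rewrite -EFin_Rintegral// lee_fin; move: hn; rewrite lee_fin /entropy_dual.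
    by have := exph n; lra.
  rewrite addeAC -EFinD.
  apply: (@le_trans _ _ (\int[mu]_x (EFin \o h n)^\+ x)).
    apply: ge0_le_integral => //.
    - by move=> x _; rewrite lee_fin.
    - by apply/measurable_EFinP.
    - exact: measurable_funepos.
  apply: (@le_trans _ _
    (\int[mu]_x (h n x)%:E + \int[mu]_x (EFin \o h n)^\- x)).
    rewrite [X in _ <= X + _]integralE subeK//.
    by rewrite integrable_neg_fin_num//; exact: bounded_measurable_integrable.
  exact: leeD.
have acvg : \int[mu]_x (a n x)%:E @[n --> \oo] --> \int[mu]_x l^\+ x.
  under [X in _ --> X]eq_integral do rewrite funeposE -EFin_max.
  apply: cvg_nondecreasing_integral => //.
  - move=> x m n mn; rewrite /a le_min !ge_min lexx/= orbC.
    by rewrite ler_nat mn.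
  - move=> x; apply: cvg_near_cst.
    exists (Num.bound (Num.max (ln (g x)) 0%R)) => // n /= bn.
    apply/min_idPl; apply: ltW; apply: (lt_le_trans (archi_boundP _)).
      by rewrite le_max lexx orbT.
    by rewrite ler_nat.
rewrite -/l -(cvg_lim _ acvg)//; apply: lime_le; last exact: nearW.
by apply/cvg_ex; exists (\int[mu]_x l^\+ x).
Qed.

Lemma KL_ge0 mu nu : 0 <= KL mu nu.
Proof.
rewrite -[0](congr1 EFin (entropy_dual0 mu nu)).
by apply: entropy_dual_le_KL; exact: bounded_measurable_cst.
Qed.

(** The measure m dominates a mu, hence the dual value is at most the integral
    against mu of h + 1 - a e^h, which is pointwise at most - ln a. With a = 1/2
    this is the bound ln 2, and with a = 1 it says that KL(mu || mu) <= 0. *)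
Lemma KL_mixture_le_ln (a b : R) mu nu m : (0 < a)%R -> (0 <= b)%R ->
  (forall A, measurable A -> m A = a%:E * mu A + b%:E * nu A) ->
  KL mu m <= (- ln a)%:E.
Proof.
move=> a0 b0 mE; apply: KL_le_entropy_dual => h bh; rewrite lee_fin.
have bexp := bounded_measurable_expR bh.
have exp0 : (0 <= \int[nu]_x expR (h x))%R.
  by apply: Rintegral_ge0 => x _; exact: expR_ge0.
have hle : (\int[mu]_x h x <= \int[mu]_x (a * expR (h x) + (- ln a - 1)))%R.
  apply: Rintegral_le => // [|x].
    apply: bounded_measurable_add; first exact: bounded_measurable_scale.
    exact: bounded_measurable_cst.
  have := expR_ge1Dx (h x + ln a)%R.
  by rewrite expRD lnK ?posrE//; lra.
rewrite Rintegral_add ?Rintegral_scale ?Rintegral_cst_probability// in hle;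
  last 2 first.
- exact: bounded_measurable_scale.
- exact: bounded_measurable_cst.
rewrite /entropy_dual (Rintegral_mixture (ltW a0) b0 mE bexp).
by have := mulr_ge0 b0 exp0; lra.
Qed.

Lemma KL_refl mu : KL mu mu = 0.
Proof.
apply/eqP; rewrite eq_le KL_ge0 andbT.
rewrite -[leRHS]oppe0 -[X in - X](congr1 EFin (@ln1 R)).
apply: (@KL_mixture_le_ln 1 0 mu mu) => // A _.
by rewrite mul1e mul0e adde0.
Qed.

(** The dual expression is affine in the pair of measures. *)
Lemma KL_mixture_convex (a b : R) mu1 mu2 nu1 nu2 mu nu :
  (0 <= a)%R -> (0 <= b)%R ->
  (forall A, measurable A -> mu A = a%:E * mu1 A + b%:E * mu2 A) ->
  (forall A, measurable A -> nu A = a%:E * nu1 A + b%:E * nu2 A) ->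
  KL mu nu <= a%:E * KL mu1 nu1 + b%:E * KL mu2 nu2.
Proof.
move=> a0 b0 muE nuE; apply: KL_le_entropy_dual => h bh.
have ab1 : (a + b = 1)%R.
  have := muE setT measurableT.
  by rewrite !probability_setT !mule1 -EFinD => -[].
have -> : entropy_dual mu nu h =
    (a * entropy_dual mu1 nu1 h + b * entropy_dual mu2 nu2 h)%R.
  rewrite /entropy_dual (Rintegral_mixture a0 b0 muE bh).
  rewrite (Rintegral_mixture a0 b0 nuE (bounded_measurable_expR bh)).
  by rewrite -[X in (_ + X - _)%R]ab1; lra.
by rewrite EFinD !EFinM leeD// lee_wpmul2l ?lee_fin// entropy_dual_le_KL.
Qed.

Lemma expR_le_quadratic (x : R) : (x <= 2^-1 -> expR x <= 1 + x + 2 * x ^+ 2)%R.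
Proof.
move=> x2; have := expR_ge1Dx (- x); rewrite expRN => xe.
have e0 := expR_gt0 x.
have : ((1 - x) * expR x <= 1)%R.
  by rewrite -[leRHS](mulVf (lt0r_neq0 e0)) ler_wpM2r// ltW.
have : (1 <= (1 - x) * (1 + x + 2 * x ^+ 2))%R.
  have : (0 <= x ^+ 2 * (1 - 2 * x))%R by rewrite mulr_ge0 ?sqr_ge0//; lra.
  by rewrite expr2; nra.
move=> h1 h2; have := le_trans h2 h1; rewrite ler_pM2l//; lra.
Qed.

(** For |s| = t the dual inequality at h = s f, together with
    e^u <= 1 + u + 2 u^2, bounds s (\int f dmu - \int f dnu) by
    KL(mu || nu) + 2 t^2; use both signs of s. *)
Lemma KL_small_Rintegral (t : R) mu nu f : bounded_measurable f ->
  (forall x, `|f x| <= 1)%R -> (0 < t <= 2^-1)%R -> KL mu nu <= (t ^+ 2)%:E ->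
  (`|\int[mu]_x f x - \int[nu]_x f x| <= 3 * t)%R.
Proof.
move=> bf f1 /andP[t0 t2] KLt.
suff one_sided s : (`|s| = t)%R ->
    (s * (\int[mu]_x f x - \int[nu]_x f x) <= 3 * t ^+ 2)%R.
  have tN : (`|- t| = t)%R by rewrite normrN gtr0_norm.
  have := one_sided _ tN; have := one_sided _ (gtr0_norm t0).
  move=> h1 h2; rewrite ler_norml.
  by apply/andP; split; rewrite -(ler_pM2l t0); nra.
move=> st; have bs := bounded_measurable_scale s bf.
have := le_trans (entropy_dual_le_KL mu nu bs) KLt.
rewrite lee_fin /entropy_dual Rintegral_scale//.
have : (\int[nu]_x expR (s * f x) <= \int[nu]_x ((1 + 2 * t ^+ 2) + s * f x))%R.
  apply: Rintegral_le => [||x]; first exact: bounded_measurable_expR.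
    by apply: bounded_measurable_add => //; exact: bounded_measurable_cst.
  have sf : (`|s * f x| <= t)%R by rewrite normrM st ler_piMr// ltW.
  apply: le_trans (expR_le_quadratic _) _.
    by rewrite (le_trans (ler_norm _))// (le_trans sf).
  have : ((s * f x) ^+ 2 <= t ^+ 2)%R.
    by rewrite -real_normK ?num_real// lerXn2r ?nnegrE// ltW.
  lra.
rewrite Rintegral_add ?Rintegral_scale ?Rintegral_cst_probability//; last first.
  exact: bounded_measurable_cst.
lra.
Qed.

End relative_entropy.

(** * Bounded continuous functions determine a measure on a metrizable space *)

Lemma continuous_borel_measurable (R : realType) (X : ptopologicalType)
    (f : X -> R) : continuous f -> measurable_fun setT (f : borel X -> R).
Proof.
move=> /continuousP cf.
apply: (measurability _ (RGenOpens.measurableE R)) => //.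
move=> _ [_ [a [b ->]] <-]; apply: sub_sigma_algebra.
by rewrite setTI; apply: cf; exact: interval_open.
Qed.

Section metric.
Context (R : realType) (X : topologicalType) (d : X -> X -> R).
Hypothesis d0 : forall x y, (d x y = 0)%R <-> x = y.
Hypothesis dC : forall x y, d x y = d y x.
Hypothesis dD : forall x y z, (d x z <= d x y + d y z)%R.
Hypothesis nbhsE : forall x (A : set X), nbhs x A <->
  exists2 e : R, (0 < e)%R & [set y | d x y < e]%R `<=` A.

Lemma dist_ge0 x y : (0 <= d x y)%R.
Proof.
have dxx : (d x x = 0)%R by exact/d0.
by have := dD x y x; rewrite dxx (dC y x); lra.
Qed.

Definition dist_set (C : set X) x : R := inf [set d x y | y in C].

Lemma dist_set_le (C : set X) x y : C y -> (dist_set C x <= d x y)%R.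
Proof.
move=> Cy; apply: ge_inf; last by exists y.
by exists 0%R => _ [z _ <-]; exact: dist_ge0.
Qed.

Lemma le_dist_set (C : set X) x e : C !=set0 ->
  (forall y, C y -> e <= d x y)%R -> (e <= dist_set C x)%R.
Proof.
move=> [y Cy] h; apply: lb_le_inf; first by exists (d x y); exists y.
by move=> _ [z Cz <-]; exact: h.
Qed.

Lemma dist_set_lip (C : set X) x y : C !=set0 ->
  (dist_set C x - dist_set C y <= d x y)%R.
Proof.
move=> C0; rewrite lerBlDl -lerBlDr; apply: le_dist_set => // z Cz.
have := dist_set_le x Cz; have := dD x y z; lra.
Qed.

Lemma dist_set_continuous (C : set X) : C !=set0 -> continuous (dist_set C).
Proof.
move=> C0 x; apply/cvgrPdist_lt => e e0.
apply/nbhsE; exists e => // y /= dxy.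
rewrite (le_lt_trans _ dxy)// ler_norml dist_set_lip// andbT.
by rewrite lerNl opprB dC dist_set_lip.
Qed.

(** The functions min(1, n dist(x, complement of U)). The whole space is treated
    apart, since the infimum over the empty set is not a distance. *)
Lemma open_indicator_approx (U : set X) : open U ->
  exists a : nat -> X -> R, [/\ (forall n, continuous (a n)),
    (forall n x, 0 <= a n x <= 1)%R,
    (forall x m n, (m <= n)%N -> (a m x <= a n x)%R) &
    (forall x, a n x @[n --> \oo] --> (\1_U x : R)%R)].
Proof.
move=> oU; have [C0|/set0P C0] := eqVneq (~` U) set0.
  exists (fun _ _ => 1%R); split => //.
  - by move=> n x; exact: cvg_cst.
  - by move=> n x; rewrite lexx ler01.
  - move=> x; rewrite indicE -[U]setCK C0 setC0 in_setT; exact: cvg_cst.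
have r0 x : (0 <= dist_set (~` U) x)%R.
  by apply: le_dist_set => // y _; exact: dist_ge0.
exists (fun n x => Num.min 1 (n%:R * dist_set (~` U) x))%R; split.
- move=> n x.
  apply: (@continuous_min R X (cst 1%R)
    (fun x => n%:R * dist_set (~` U) x)%R).
    exact: cvg_cst.
  by apply: cvgM; [exact: cvg_cst|exact: dist_set_continuous].
- by move=> n x; rewrite le_min ge_min lexx ler01 mulr_ge0.
- move=> x m n mn; rewrite le_min !ge_min lexx/= orbC ler_wpM2r// ler_nat//.
- move=> x; rewrite indicE; have [Ux|nUx] := pselect (U x); last first.
    rewrite memNset//.
    rewrite (_ : dist_set _ x = 0)%R.
      rewrite /= (_ : (fun n => _) = cst 0%R); first exact: cvg_cst.
      by apply/funext => n; rewrite mulr0 min_r.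
    apply/eqP; rewrite eq_le r0 andbT (le_trans (dist_set_le x nUx))//.
    by rewrite le_eqVlt; apply/orP; left; apply/eqP/d0.
  rewrite mem_set//.
  have /nbhsE[e e0 eU] : nbhs x U by exact: open_nbhs_nbhs.
  have er : (e <= dist_set (~` U) x)%R.
    by apply: le_dist_set => // y nUy; rewrite leNgt; apply/negP => /eU.
  apply: cvg_near_cst; exists (Num.bound e^-1) => // n /= bn.
  apply/min_idPl; rewrite (@le_trans _ _ (n%:R * e)%R) ?ler_wpM2l//.
  rewrite -ler_pdivrMr// div1r ltW// (lt_le_trans (archi_boundP _))//.
    by rewrite invr_ge0 ltW.
  by rewrite ler_nat.
Qed.
End metric.

Section weak_topology.
Context (R : realType) (X : ptopologicalType).
Implicit Types (mu nu q : borel_probability X R).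
Implicit Types (P Q : set (borel_probability X R)).

Lemma bounded_continuous_measurable (f : bounded_continuous R X) :
  bounded_measurable (sval f : borel X -> R).
Proof.
case: f => f /= [cf [M [_ fM]]]; split.
  exact: continuous_borel_measurable.
by exists (M + 1)%R => x; apply: fM => //; rewrite ltrDl.
Qed.

(** By monotone convergence the two measures agree on open sets, which form a
    generating system closed under intersection. *)
Lemma eq_probability_bounded_continuous mu nu : completely_metrizable R X ->
  (forall f : bounded_continuous R X, (forall x, `|sval f x| <= 1)%R ->
    integrals mu f = integrals nu f) ->
  forall A, measurable A -> mu A = nu A.
Proof.
move=> [d [d0 dC dD nbhsE _]] eq_int.
move=> A; apply: (@measure_unique _ R (borel X) (@open X) (fun=> setT)).
- by [].
- by move=> U V; exact: openI.
- by move=> _; exact: openT.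
- by rewrite bigcup_const//; exists 0%N.
- move=> U oU.
  have mU : measurable (U : set (borel X)) by exact: sub_sigma_algebra.
  have [a [ca a01 nda aU]] := open_indicator_approx d0 dC dD nbhsE oU.
  have a1 n x : (`|a n x| <= 1)%R.
    by have /andP[a0 a1] := a01 n x; rewrite ger0_norm.
  have bca n : continuous (a n) /\ bounded_fun (a n).
    split; first exact: ca.
    exists 1%R; split; first exact: num_real.
    by move=> M M1 x _; exact: le_trans (a1 n x) (ltW M1).
  pose f n : bounded_continuous R X := exist _ (a n) (bca n).
  have cvgU (k : borel_probability X R) :
      (integrals k (f n))%:E @[n --> \oo] --> k U.
    have -> : k U = \int[k]_x (\1_U x)%:E by rewrite integral_indic// setIT.
    under eq_fun do
      rewrite (EFin_Rintegral k (bounded_continuous_measurable (f _))).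
    apply: (@cvg_nondecreasing_integral _ (borel X) R k a) => //.
    + by move=> n; exact: continuous_borel_measurable.
    + by move=> n x; have /andP[] := a01 n x.
  have eq_seq : (fun n => (integrals mu (f n))%:E) =
                (fun n => (integrals nu (f n))%:E).
    by apply/funext => n; rewrite eq_int //; exact: a1.
  have := cvgU mu; rewrite eq_seq => muU.
  exact: (cvg_unique _ muU (cvgU nu)).
- by move=> _; rewrite (le_lt_trans (probability_le1 mu measurableT)) ?ltry.
Qed.

(** A cluster point in Q of a sequence whose integrals converge to those of mu.
    The conclusion is equality of integrals rather than membership of mu, since
    the weak topology does not separate probabilities that coincide on Borel
    sets. *)
Lemma weakly_compact_closed Q mu : weakly_compact Q ->
  (forall e : R, (0 < e)%R -> exists2 q, Q q &
    forall f : bounded_continuous R X, (forall x, `|sval f x| <= 1)%R ->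
      (`|integrals mu f - integrals q f| <= e)%R) ->
  exists2 q, Q q & forall f : bounded_continuous R X,
      (forall x, `|sval f x| <= 1)%R -> integrals mu f = integrals q f.
Proof.
move=> cQ approx.
have /choice[u uP] : forall n : nat, exists q, Q q /\
    forall f : bounded_continuous R X, (forall x, `|sval f x| <= 1)%R ->
      (`|integrals mu f - integrals q f| <= n.+1%:R^-1)%R.
  move=> n; have [q Qq qmu] := approx n.+1%:R^-1%R ltac:(by rewrite invr_gt0).
  by exists q.
pose v : nat -> weak_probability R X := u.
have [q [Qq cq]] := cQ (v @ \oo) _ (filterE _ (fun n => (uP n).1)).
exists q => // f f1; apply/eqP.
rewrite -subr_eq0 -normr_eq0 eq_le normr_ge0 andbT.
apply/ler_addgt0Pr => e e0; rewrite add0r.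
pose ev (m : weak_probability R X) : R := integrals m f.
(* Evaluation at f is a projection of the product topology. *)
have ev_cts : continuous ev.
  move=> m; apply: (@continuous_comp _ _ _
    (@integrals R X : weak_probability R X -> _) (fun g => g f)).
    exact: initial_continuous.
  move=> A.
  have /cvg_sup/(_ f) gf : (integrals m : {ptws _ -> _}) --> integrals m.
    exact: cvg_id.
  pose pr (g : bounded_continuous R X -> R) := g f.
  by move=> /(@initial_continuous _ _ pr) /gf.
have e20 : (0 < e / 2)%R by rewrite divr_gt0.
have nq : nbhs (q : weak_probability R X) [set m | `|ev q - ev m| < e / 2]%R.
  by have /cvgrPdist_lt := ev_cts q; apply.
have v_close : (v @ \oo) [set m | `|integrals mu f - ev m| <= e / 2]%R.
  exists (Num.bound (e / 2)^-1) => // n /= bn.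
  apply: (le_trans ((uP n).2 f f1)).
  rewrite invf_ple ?posrE// ltW// (lt_le_trans (archi_boundP _))//.
    by rewrite invr_ge0 ltW.
  by rewrite ler_nat leqW.
have [m [/= h1 h2]] := cq _ _ v_close nq.
rewrite -/(ev q).
rewrite (_ : _ - _ = (integrals mu f - ev m) - (ev q - ev m))%R; last by lra.
by rewrite (le_trans (ler_normB _ _))//; move: h1 h2; lra.
Qed.

End weak_topology.

(** * Divergences between sets of probability measures *)

Section set_divergences.
Context (R : realType) (X : ptopologicalType).
Implicit Types (mu nu : borel_probability X R).
Implicit Types (P Q N : set (borel_probability X R)).

Lemma KL_set_ge0 P Q : P !=set0 -> 0 <= KL_set P Q.
Proof.
move=> [mu Pmu]; apply: ereal_sup_ge.
exists (ereal_inf [set KL mu nu | nu in Q]); first by exists mu.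
by apply: le_ereal_inf_tmp => _ [nu _ <-]; exact: KL_ge0.
Qed.

Lemma KL_set_le P Q (c : \bar R) :
  (forall mu, P mu -> exists2 nu, Q nu & KL mu nu <= c) -> KL_set P Q <= c.
Proof.
move=> h; apply: ge_ereal_sup => _ [mu Pmu <-].
have [nu Qnu le_c] := h _ Pmu.
by apply: le_trans le_c; apply: ereal_inf_lbound; exists nu.
Qed.

Lemma KL_set_lt P Q (c : \bar R) mu : KL_set P Q < c -> P mu ->
  exists2 nu, Q nu & KL mu nu < c.
Proof.
move=> PQc Pmu.
have /ereal_inf_lt[_ [nu Qnu <-] h] : ereal_inf [set KL mu nu | nu in Q] < c.
  by apply: le_lt_trans PQc; apply: ereal_sup_ubound; exists mu.
by exists nu.
Qed.

Lemma combinationC (a b : R) P Q : combination a b P Q = combination b a Q P.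
Proof.
apply/seteqP; split => m [mu Pmu [nu Qnu mE]];
  by exists nu => //; exists mu => // A mA; rewrite mE// addeC.
Qed.

Lemma combination_mixture (a b : R) P Q mu nu : (0 <= a)%R -> (0 <= b)%R ->
  (a + b = 1)%R -> P mu -> Q nu ->
  exists2 m, combination a b P Q m & forall A, m A = a%:E * mu A + b%:E * nu A.
Proof.
move=> a0 b0 ab1 Pmu Qnu; have [m mE] := mixture_exists mu nu a0 b0 ab1.
by exists m => //; exists mu => //; exists nu.
Qed.

(** This is l1 (a p1 + b q1) + l2 (a p2 + b q2)
    = a (l1 p1 + l2 p2) + b (l1 q1 + l2 q2), read on measures. *)
Lemma combination_interchange (a b l1 l2 : R) P1 P2 Q1 Q2 :
  (0 <= l1)%R -> (0 <= l2)%R -> (l1 + l2 = 1)%R ->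
  combination l1 l2 (combination a b P1 Q1) (combination a b P2 Q2) `<=`
  combination a b (combination l1 l2 P1 P2) (combination l1 l2 Q1 Q2).
Proof.
move=> l10 l20 l12 m [m1 [p1 Pp1 [q1 Qq1 m1E]] [m2 [p2 Pp2 [q2 Qq2 m2E]] mE]].
have [p Pp pE] := combination_mixture l10 l20 l12 Pp1 Pp2.
have [q Qq qE] := combination_mixture l10 l20 l12 Qq1 Qq2.
exists p => //; exists q => // A mA.
have fin (k : borel_probability X R) : k A = (fine (k A))%:E.
  by rewrite fineK// fin_num_measure.
rewrite mE// m1E// m2E// pE qE (fin p1) (fin p2) (fin q1) (fin q2).
rewrite !(=^~ EFinM, =^~ EFinD); congr EFin; ring.
Qed.

Let half_ge0 : (0 <= 2^-1 :> R)%R. Proof. by rewrite invr_ge0. Qed.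
Let half_half : (2^-1 + 2^-1 = 1 :> R)%R. Proof. by lra. Qed.

Lemma JS_sym P Q : JS P Q = JS Q P.
Proof. by rewrite /JS combinationC addeC. Qed.

Lemma KL_set_mean_le_ln2 P Q : Q !=set0 ->
  KL_set P (combination 2^-1 2^-1 P Q) <= (ln (2 : R))%:E.
Proof.
move=> [nu Qnu]; apply: KL_set_le => mu Pmu.
have [m Mm mE] := combination_mixture half_ge0 half_ge0 half_half Pmu Qnu.
exists m => //; rewrite -[ln 2]opprK -lnV ?posrE//.
by apply: (@KL_mixture_le_ln _ _ _ _ 2^-1 mu nu) => //; rewrite invr_gt0.
Qed.

Lemma KL_set_mean_fin P Q : P !=set0 -> Q !=set0 ->
  KL_set P (combination 2^-1 2^-1 P Q) \is a fin_num.
Proof.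
move=> P0 Q0; rewrite ge0_fin_numE ?KL_set_ge0//.
by rewrite (le_lt_trans (KL_set_mean_le_ln2 _ Q0))// ltry.
Qed.

Lemma JS_bounds P Q : P !=set0 -> Q !=set0 -> 0 <= JS P Q <= (ln (2 : R))%:E.
Proof.
move=> P0 Q0; apply/andP; split.
  by rewrite adde_ge0// mule_ge0 ?KL_set_ge0// lee_fin.
have half_le P' Q' : Q' !=set0 ->
    2^-1%:E * KL_set P' (combination 2^-1 2^-1 P' Q') <= (2^-1 * ln 2)%:E.
  by move=> Q'0; rewrite EFinM lee_wpmul2l ?lee_fin// KL_set_mean_le_ln2.
have -> : (ln (2 : R) = 2^-1 * ln 2 + 2^-1 * ln 2)%R by lra.
by rewrite EFinD leeD ?half_le// combinationC half_le.
Qed.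

Lemma JS_refl P : P !=set0 -> JS P P = 0.
Proof.
move=> P0; suff KL0 : KL_set P (combination 2^-1 2^-1 P P) = 0.
  by rewrite /JS KL0 mule0 adde0.
apply/eqP; rewrite eq_le KL_set_ge0// andbT; apply: KL_set_le => mu Pmu.
exists mu; last by rewrite KL_refl.
exists mu => //; exists mu => // A mA.
by rewrite -ge0_muleDl ?lee_fin// -EFinD half_half mul1e.
Qed.

(** Mix near-optimal elements of N1 and N2. The mixture is within epsilon of the
    right-hand side, because l1 epsilon + l2 epsilon = epsilon. *)
Lemma KL_set_convex (l1 l2 : R) P1 P2 N1 N2 N : (0 <= l1)%R -> (0 <= l2)%R ->
  (l1 + l2 = 1)%R -> combination l1 l2 N1 N2 `<=` N ->
  KL_set P1 N1 \is a fin_num -> KL_set P2 N2 \is a fin_num ->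
  KL_set (combination l1 l2 P1 P2) N <=
  l1%:E * KL_set P1 N1 + l2%:E * KL_set P2 N2.
Proof.
move=> l10 l20 l12 subN f1 f2; apply/lee_addgt0Pr => e e0.
apply: KL_set_le => mu [mu1 Pmu1 [mu2 Pmu2 muE]].
have near_opt P' N' mu' : KL_set P' N' \is a fin_num -> P' mu' ->
    exists2 nu', N' nu' & KL mu' nu' < KL_set P' N' + e%:E.
  by move=> f' P'mu'; apply: KL_set_lt P'mu'; rewrite lteDl ?lte_fin.
have [nu1 Nnu1 h1] := near_opt _ _ _ f1 Pmu1.
have [nu2 Nnu2 h2] := near_opt _ _ _ f2 Pmu2.
have [nu Nnu nuE] := combination_mixture l10 l20 l12 Nnu1 Nnu2.
exists nu; first exact: subN.
apply: le_trans (KL_mixture_convex l10 l20 muE (fun A _ => nuE A)) _.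
apply: (@le_trans _ _ (l1%:E * (KL_set P1 N1 + e%:E) +
                       l2%:E * (KL_set P2 N2 + e%:E))).
  by rewrite leeD// lee_wpmul2l ?lee_fin// ltW.
rewrite -(fineK f1) -(fineK f2) !(=^~ EFinM, =^~ EFinD) lee_fin.
have : (l1 * e + l2 * e = e)%R by rewrite -mulrDl l12 mul1r.
by lra.
Qed.

Lemma JS_convex (l1 l2 : R) P1 P2 Q1 Q2 :
  P1 !=set0 -> P2 !=set0 -> Q1 !=set0 -> Q2 !=set0 ->
  (0 <= l1)%R -> (0 <= l2)%R -> (l1 + l2 = 1)%R ->
  JS (combination l1 l2 P1 P2) (combination l1 l2 Q1 Q2) <=
  l1%:E * JS P1 Q1 + l2%:E * JS P2 Q2.
Proof.
move=> P10 P20 Q10 Q20 l10 l20 l12.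
have subN := @combination_interchange 2^-1 2^-1 l1 l2 P1 P2 Q1 Q2 l10 l20 l12.
have fP1 := KL_set_mean_fin P10 Q10.
have fP2 := KL_set_mean_fin P20 Q20.
have := KL_set_mean_fin Q10 P10; rewrite combinationC => fQ1.
have := KL_set_mean_fin Q20 P20; rewrite combinationC => fQ2.
have hP := KL_set_convex l10 l20 l12 subN fP1 fP2.
have hQ := KL_set_convex l10 l20 l12 subN fQ1 fQ2.
rewrite /JS; apply: le_trans (leeD (lee_wpmul2l _ hP) (lee_wpmul2l _ hQ)) _.
- by rewrite lee_fin.
- by rewrite lee_fin.
rewrite -(fineK fP1) -(fineK fP2) -(fineK fQ1) -(fineK fQ2).
rewrite !(=^~ EFinM, =^~ EFinD) lee_fin le_eqVlt; apply/orP; left; apply/eqP.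
 by ring.
Qed.

Lemma bounded_continuous_Rintegral_le1 mu (f : bounded_continuous R X) :
  (forall x, `|sval f x| <= 1)%R -> (`|integrals mu f| <= 1)%R.
Proof.
move=> f1; have bf := bounded_continuous_measurable f.
have bc c := @bounded_measurable_cst _ (borel X) R c.
rewrite ler_norml -[X in (- X <= _ <= X)%R](Rintegral_cst_probability mu).
rewrite -mulN1r -(Rintegral_scale mu (-1) (bc 1%R)).
apply/andP; split; apply: Rintegral_le => //.
- exact: bounded_measurable_scale.
- by move=> x; have := f1 x; rewrite /= mulr1 ler_norml => /andP[].
- exact: bc.
- by move=> x; have := f1 x; rewrite ler_norml => /andP[].
Qed.

(** By induction on n: mu is within r/2 of a midpoint (p + q)/2, with
    r = (3/4)^n, and p is within 2 r of some q' in Q; hence mu is within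
    r/2 + (2 r)/2 = 2 (3/4)^(n+1) of (q' + q)/2, which is in Q by convexity. *)
Lemma close_by_halving P Q : Q !=set0 -> convex_probabilities Q ->
  KL_set P (combination 2^-1 2^-1 P Q) <= 0 ->
  forall n mu, P mu -> exists2 q, Q q &
    forall f : bounded_continuous R X, (forall x, `|sval f x| <= 1)%R ->
      (`|integrals mu f - integrals q f| <= 2 * (3 / 4) ^+ n)%R.
Proof.
move=> [q0 Qq0] cQ KL0; elim=> [|n IH] mu Pmu.
  exists q0 => // f f1; rewrite expr0 mulr1 (le_trans (ler_normB _ _))//.
  by rewrite [leRHS](_ : _ = 1 + 1)%R// lerD// bounded_continuous_Rintegral_le1.
set r : R := ((3 / 4) ^+ n)%R.
have r0 : (0 < r)%R by rewrite exprn_gt0//; lra.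
have r1 : (r <= 1)%R by rewrite exprn_ile1//; lra.
(* Chosen such that the error 3 t of the midpoint is r / 2. *)
pose t : R := (r / 6)%R.
have t2 : (0 < t <= 2^-1)%R by rewrite /t; apply/andP; split; lra.
have t20 : 0 < (t ^+ 2)%:E by rewrite lte_fin exprn_gt0//; case/andP: t2.
have [m [p Pp [q Qq mE]] KLm] := KL_set_lt (le_lt_trans KL0 t20) Pmu.
have [q' Qq' q'p] := IH _ Pp.
have [q2 Qq2 q2E] := combination_mixture half_ge0 half_ge0 half_half Qq' Qq.
have half01 : (0 <= (2^-1 : R) <= 1)%R by lra.
exists q2; first exact: (cQ _ _ half01 half01 half_half).
move=> f f1; have bf := bounded_continuous_measurable f.
have := KL_small_Rintegral bf f1 t2 (ltW KLm); have := q'p f f1.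
have q2E' A : measurable A -> q2 A = 2^-1%:E * q' A + 2^-1%:E * q A by [].
rewrite /integrals (Rintegral_mixture half_ge0 half_ge0 mE bf).
rewrite (Rintegral_mixture half_ge0 half_ge0 q2E' bf) exprS -/r /t.
rewrite !ler_norml => /andP[? ?] /andP[? ?].
by apply/andP; split; lra.
Qed.

Lemma subset_of_KL_set_mean0 P Q : completely_metrizable R X -> Pbar Q ->
  KL_set P (combination 2^-1 2^-1 P Q) <= 0 -> P `<=` Q.
Proof.
move=> metX [Q0 compQ cQ] KL0 mu Pmu.
have [e e0|q Qq qmu] := @weakly_compact_closed R X Q mu compQ.
  have cvg0 : ((3 / 4 : R) ^+ n)%R @[n --> \oo] --> (0 : R)%R.
    by apply: cvg_expr; rewrite ger0_norm; lra.
  have e20 : (0 < e / 2)%R by rewrite divr_gt0.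
  have [n _ /(_ n (leqnn n)) /= hn] := cvgr0_norm_lt _ cvg0 _ e20.
  have [q Qq qmu] := close_by_halving Q0 cQ KL0 n Pmu.
  exists q => // f f1; apply: le_trans (qmu f f1) _.
  by move: hn; rewrite ltr_norml => /andP[_ ?]; lra.
have muq := eq_probability_bounded_continuous metX qmu.
have le01 : (0 <= (0 : R) <= 1)%R by lra.
have le11 : (0 <= (1 : R) <= 1)%R by lra.
(* Convexity with weights 1 and 0: Q is closed under equality on Borel sets. *)
apply: (cQ 1%R 0%R le11 le01 (addr0 _)).
by exists q => //; exists q => // A mA; rewrite mul1e mul0e adde0 muq.
Qed.

Lemma JS_eq0 P Q : completely_metrizable R X -> Pbar P -> Pbar Q ->
  JS P Q = 0 -> P = Q.
Proof.
move=> metX PP PQ JS0.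
have [P0 _ _] := PP; have [Q0 _ _] := PQ.
have half_gt0 : (0 < 2^-1 :> R)%R by rewrite invr_gt0.
have KL0 P' Q' : P' !=set0 -> Q' !=set0 -> JS P' Q' = 0 ->
    KL_set P' (combination 2^-1 2^-1 P' Q') <= 0.
  move=> P'0 Q'0 /eqP; rewrite padde_eq0 ?mule_ge0 ?KL_set_ge0 ?lee_fin//.
  by move=> /andP[+ _]; rewrite mule_eq0 eqe gt_eqF//= => /eqP ->.
apply/seteqP; split; apply: subset_of_KL_set_mean0 => //; apply: KL0 => //.
by rewrite JS_sym.
Qed.

End set_divergences.

Theorem corollary2 (R : realType) (X : ptopologicalType) (hX : polish R X) :
  [/\ (forall P Q : set (borel_probability X R), Pbar P -> Pbar Q ->
         0 <= JS P Q <= (ln (2 : R))%:E),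
      (forall P Q : set (borel_probability X R), Pbar P -> Pbar Q ->
         (JS P Q = 0 <-> P = Q)) &
      (forall P1 P2 Q1 Q2 : set (borel_probability X R),
         Pbar P1 -> Pbar P2 -> Pbar Q1 -> Pbar Q2 ->
         forall l1 l2 : R,
           (0 <= l1 <= 1)%R -> (0 <= l2 <= 1)%R -> (l1 + l2 = 1)%R ->
           JS (combination l1 l2 P1 P2) (combination l1 l2 Q1 Q2)
             <= l1%:E * JS P1 Q1 + l2%:E * JS P2 Q2)].
Proof.
have [_ metX] := hX; split.
- by move=> P Q [P0 _ _] [Q0 _ _]; exact: JS_bounds.
- move=> P Q PP PQ; split; first exact: JS_eq0.
  by move=> <-; case: PP => P0 _ _; exact: JS_refl.
- move=> P1 P2 Q1 Q2 [P10 _ _] [P20 _ _] [Q10 _ _] [Q20 _ _] l1 l2.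
  by move=> /andP[l10 _] /andP[l20 _]; exact: JS_convex.
Qed.
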